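(* Let $\Gamma_\square(x_1,\dots,x_g)=\big(x_1,\dots,x_g,\sum_{j=1}^gx_j^2\big)$. Let $V:\mathcal H\to\mathcal K$ be an isometry, put $P=VV^*$, and let $X=(X_1,\dots,X_g)$ be a tuple of bounded self-adjoint operators on $\mathcal K$. Then $(X,V)$ is a $\Gamma_\square$-pair if and only if $\operatorname{ran}V$ reduces every $X_j$. Consequently every (self-adjoint) free function is both intrinsically $\Gamma_\square$-convex and intrinsically $\Gamma_\square$-concave.
   Context: $(X,V)$ is a $\Gamma$-pair if $V^*\Gamma(X)V=\Gamma(V^*XV)$, coordinatewise. A self-adjoint free function $f$ on a real free set $D$ (a collection of self-adjoint tuples over all Hilbert spaces, invariant under simultaneous unitary conjugation, closed under reducing subspaces and under uniformly bounded direct sums with at most $2^{\aleph_0}$ summands) is a graded self-adjoint-operator-valued map respecting unitary conjugation, direct sums and reducing restrictions. It is intrinsically $\Gamma$-convex if $f(V^*XV)\preceq V^*f(X)V$ for every $\Gamma$-pair $(X,V)$ with $X,V^*XV\in D$, and intrinsically $\Gamma$-concave if the reverse inequality always holds. *)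

(* Defs.v *)
From HB Require Import structures.
From mathcomp Require Import all_boot all_order all_algebra.
From mathcomp Require Import all_classical all_reals all_analysis.
From mathcomp Require Import complex.

Set Implicit Arguments.
Unset Strict Implicit.
Unset Printing Implicit Defensive.

Import Order.TTheory GRing.Theory Num.Theory.
Import numFieldNormedType.Exports.

Local Open Scope classical_set_scope.
Local Open Scope ring_scope.

(* Complex Hilbert spaces; dot is linear on the left and conjugate-linear on
   the right. *)
Record hilbert (R : realType) := Hilbert {
  hilbert_sort :> completeNormedModType R[i];
  dot : {dot hilbert_sort for (@Num.conj R[i])};
  dot_norm : forall x, dot x x = `|x| ^+ 2
}.
Arguments dot {R h}.

Section BoundedOperators.
Variable R : realType.

Record bounded_op (H K : hilbert R) := BoundedOp {
  bop_fun :> H -> K;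
  bop_linear : linear bop_fun;
  bop_bounded : exists M : R, forall x, `|bop_fun x| <= (M%:C)%C * `|x|
}.

HB.instance Definition _ (H K : hilbert R) (A : bounded_op H K) :=
  GRing.isLinear.Build R[i] H K _ (bop_fun A) (bop_linear A).

Section Structure.
Variables H K : hilbert R.
Implicit Types A B : bounded_op H K.

Lemma bounded_opP A B : (forall x, A x = B x) -> A = B.
Proof.
case: A B => [f lf bf] [h lh bh] /= /funext fh; move: lf bf lh bh.
by rewrite fh => lf bf lh bh; congr BoundedOp; exact: Prop_irrelevance.
Qed.

Fact zero_op_linear : linear (fun _ : H => 0 : K).
Proof. by move=> a x y; rewrite scaler0 addr0. Qed.
Fact zero_op_bounded :
  exists M : R, forall x : H, `|0 : K| <= (M%:C)%C * `|x|.
Proof. by exists 0 => x; rewrite normr0 mul0r. Qed.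
Definition zero_op := BoundedOp zero_op_linear zero_op_bounded.

Fact opp_op_linear A : linear (fun x => - A x).
Proof. by move=> a x y; rewrite linearP opprD scalerN. Qed.
Fact opp_op_bounded A :
  exists M : R, forall x, `|- A x| <= (M%:C)%C * `|x|.
Proof. by have [M AM] := bop_bounded A; exists M => x; rewrite normrN. Qed.
Definition opp_op A := BoundedOp (opp_op_linear A) (opp_op_bounded A).

Fact add_op_linear A B : linear (fun x => A x + B x).
Proof. by move=> a x y; rewrite !linearP scalerDr addrACA. Qed.
Fact add_op_bounded A B :
  exists M : R, forall x, `|A x + B x| <= (M%:C)%C * `|x|.
Proof.
have [[M AM] [N BN]] := (bop_bounded A, bop_bounded B).
exists (M + N) => x; rewrite rmorphD mulrDl.
by apply: le_trans (ler_normD _ _) _; rewrite lerD.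
Qed.
Definition add_op A B := BoundedOp (add_op_linear A B) (add_op_bounded A B).

HB.instance Definition _ := gen_eqMixin (bounded_op H K).
HB.instance Definition _ := gen_choiceMixin (bounded_op H K).

Fact add_opA : associative add_op.
Proof. by move=> A B C; apply: bounded_opP => x /=; rewrite addrA. Qed.
Fact add_opC : commutative add_op.
Proof. by move=> A B; apply: bounded_opP => x /=; rewrite addrC. Qed.
Fact add_op0 : left_id zero_op add_op.
Proof. by move=> A; apply: bounded_opP => x /=; rewrite add0r. Qed.
Fact add_opN : left_inverse zero_op opp_op add_op.
Proof. by move=> A; apply: bounded_opP => x /=; rewrite addNr. Qed.

HB.instance Definition _ :=
  GRing.isZmodule.Build (bounded_op H K) add_opA add_opC add_op0 add_opN.

Lemma add_opE A B x : (A + B) x = A x + B x. Proof. by []. Qed.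
Lemma opp_opE A x : (- A) x = - A x. Proof. by []. Qed.
Lemma zero_opE x : (0 : bounded_op H K) x = 0. Proof. by []. Qed.

End Structure.

Fact comp_op_linear (H K L : hilbert R) (A : bounded_op K L)
  (B : bounded_op H K) : linear (A \o B).
Proof. by move=> a x y /=; rewrite !linearP. Qed.
Fact comp_op_bounded (H K L : hilbert R) (A : bounded_op K L)
  (B : bounded_op H K) :
  exists M : R, forall x, `|(A \o B) x| <= (M%:C)%C * `|x|.
Proof.
have [[M AM] [N BN]] := (bop_bounded A, bop_bounded B).
exists (`|M| * N) => x /=; rewrite rmorphM -mulrA.
apply: le_trans (AM _) _; apply: (@le_trans _ _ ((`|M|%:C)%C * `|B x|)).
  by rewrite ler_wpM2r // lecR ler_norm.
by rewrite ler_wpM2l // lecR.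
Qed.
Definition comp_op (H K L : hilbert R) (A : bounded_op K L)
  (B : bounded_op H K) : bounded_op H L :=
  BoundedOp (comp_op_linear A B) (comp_op_bounded A B).

(* The adjoint is the unique operator W with <Ax, y> = <x, Wy>; it exists by
   the Riesz representation theorem, so the default value 0 is never taken. *)
Definition adjoint (H K : hilbert R) (A : bounded_op H K) : bounded_op K H :=
  xget 0 [set W : bounded_op K H | forall x y, dot (A x) y = dot x (W y)].

Definition self_adjoint (H : hilbert R) (A : bounded_op H H) :=
  adjoint A = A.

Definition is_isometry (H K : hilbert R) (V : bounded_op H K) :=
  forall x, `|V x| = `|x|.

Definition is_unitary (H K : hilbert R) (U : bounded_op H K) :=
  is_isometry U /\ range U = setT.

Definition loewner_le (H : hilbert R) (A B : bounded_op H H) :=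
  forall x, 0 <= dot ((B - A) x) x.

End BoundedOperators.

Notation "''B' ( H , K )" := (bounded_op H K)
  (at level 8, format "''B' ( H ,  K )") : type_scope.
Notation "''B' ( H )" := (bounded_op H H)
  (at level 8, format "''B' ( H )") : type_scope.
Notation "A \oB B" := (comp_op A B)
  (at level 40, left associativity) : ring_scope.
Notation "A ⪯ B" := (loewner_le A B) (at level 70) : ring_scope.

Section Subspaces.
Variable R : realType.

Record closed_subspace (K : hilbert R) := ClosedSubspace {
  subspace_set :> set K;
  subspace0 : subspace_set 0;
  subspaceP : forall (a : R[i]) x y,
    subspace_set x -> subspace_set y -> subspace_set (a *: x + y);
  subspace_closed : closed subspace_set
}.

Definition orthogonal_complement (K : hilbert R) (M : set K) : set K :=
  [set y | forall x, M x -> dot x y = 0].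

Definition invariant_under (K : hilbert R) (M : set K) (X : 'B(K)) :=
  forall x, M x -> M (X x).

Definition reduces (K : hilbert R) (M : set K) (X : 'B(K)) :=
  invariant_under M X /\ invariant_under (orthogonal_complement M) X.

End Subspaces.

Section SubspaceHilbert.
Variables (R : realType) (K : hilbert R) (M : closed_subspace K).

Definition subspace_pred : pred K := fun x => `[< subspace_set M x >].

Fact subspace_pred_closed : submod_closed subspace_pred.
Proof.
split=> [|a x y]; first exact/asboolP/subspace0.
by move=> /asboolP Mx /asboolP My; apply/asboolP/subspaceP.
Qed.
HB.instance Definition _ :=
  GRing.isSubmodClosed.Build R[i] K subspace_pred subspace_pred_closed.

Record subspace_of := SubspaceOf {
  subspace_val :> K;
  subspace_valP : subspace_val \in subspace_pred
}.

HB.instance Definition _ := [isSub for subspace_val].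
HB.instance Definition _ := [Choice of subspace_of by <:].
HB.instance Definition _ := [SubChoice_isSubLmodule of subspace_of by <:].

Definition subspace_norm (x : subspace_of) : R[i] := `|subspace_val x|.

Fact subspace_normD x y :
  subspace_norm (x + y) <= subspace_norm x + subspace_norm y.
Proof. exact: ler_normD. Qed.
Fact subspace_normZ (l : R[i]) x :
  subspace_norm (l *: x) = `|l| * subspace_norm x.
Proof. exact: normrZ. Qed.
Fact subspace_norm0 x : subspace_norm x = 0 -> x = 0.
Proof. by move=> /normr0_eq0 x0; apply: val_inj. Qed.

HB.instance Definition _ := Lmodule_isNormed.Build R[i] subspace_of
  subspace_normD subspace_normZ subspace_norm0.

Fact subspace_complete (F : set_system subspace_of) :
  ProperFilter F -> cauchy F -> cvg F.
Proof.
move=> FF Fc.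
have cK : cauchy (subspace_val @ F).
  apply: cauchy_exP => e e0; have /cauchyP/(_ e e0)[x Fx] := Fc.
  exists (subspace_val x).
  by rewrite -ball_normE; move: Fx; rewrite -ball_normE.
have /cvg_ex[l Fl] : cvg (subspace_val @ F) by exact: cauchy_cvg cK.
have Ml : subspace_set M l.
  apply: closed_cvg Fl; first exact: subspace_closed.
  by apply: nearW => x; exact/asboolP/subspace_valP.
have Pl : l \in subspace_pred by exact/asboolP.
apply/cvg_ex; exists (SubspaceOf Pl).
by apply/cvgrPdist_lt => e e0; move/cvgrPdist_lt : Fl => /(_ e e0).
Qed.

HB.instance Definition _ :=
  Uniform_isComplete.Build subspace_of subspace_complete.

Definition subspace_dot (x y : subspace_of) : R[i] :=
  dot (subspace_val x) (subspace_val y).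

Fact subspace_dot_bilinear :
  bilinear_for *%R (@Num.conj R[i] \; *%R) subspace_dot.
Proof.
split=> [y a x1 x2|x a y1 y2].
  exact: (linearPl (dot (h := K)) (subspace_val y)).
exact: (linearPr (dot (h := K)) (subspace_val x)).
Qed.
HB.instance Definition _ :=
  bilinear_isBilinear.Build R[i] subspace_of subspace_of R[i] _ _ subspace_dot
    subspace_dot_bilinear.
Fact subspace_dot_herm (x y : subspace_of) :
  subspace_dot x y = (-1) ^+ false * Num.conj (subspace_dot y x).
Proof. exact: hermitian_subproof. Qed.
HB.instance Definition _ := isHermitianSesquilinear.Build R[i] subspace_of
  false (@Num.conj R[i]) subspace_dot subspace_dot_herm.
Fact subspace_dot_gt0 (x : subspace_of) : x != 0 -> 0 < subspace_dot x x.
Proof.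
by move=> x0; rewrite /subspace_dot (@neq0_dnorm_gt0 _ _ _ (dot (h := K))).
Qed.
HB.instance Definition _ :=
  isDotProduct.Build R[i] subspace_of subspace_dot subspace_dot_gt0.

Fact subspace_dot_norm (x : subspace_of) : subspace_dot x x = `|x| ^+ 2.
Proof. exact: dot_norm. Qed.

Definition subspace_hilbert : hilbert R :=
  @Hilbert R subspace_of subspace_dot subspace_dot_norm.

End SubspaceHilbert.

Section FreeFunctions.
Variable R : realType.

Definition op_tuple (g : nat) (H : hilbert R) := 'I_g -> 'B(H).

Definition compression (H K : hilbert R) (V : 'B(H, K)) (A : 'B(K)) : 'B(H) :=
  adjoint V \oB A \oB V.

Definition tuple_compression (g : nat) (H K : hilbert R) (V : 'B(H, K))
    (X : op_tuple g K) : op_tuple g H :=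
  fun j => compression V (X j).

Definition graded_map (g r : nat) :=
  forall H : hilbert R, op_tuple g H -> op_tuple r H.

Definition gamma_pair (g r : nat) (Gamma : graded_map g r) (H K : hilbert R)
    (X : op_tuple g K) (V : 'B(H, K)) : Prop :=
  forall k : 'I_r,
    compression V (Gamma K X k) = Gamma H (tuple_compression V X) k.

(* (x_1, ..., x_g, x_1^2 + ... + x_g^2) *)
Definition gamma_square (g : nat) : graded_map g g.+1 :=
  fun H X k =>
    if unlift ord_max k is Some j then X j else \sum_(j < g) X j \oB X j.

(* K is the Hilbert space direct sum of the (H i) along the embeddings (J i):
   their ranges are pairwise orthogonal and their closed linear span is K.
   This fixes K up to a unitary; free sets below are unitarily invariant, so
   no particular model of the sum has to be singled out. *)
Definition hilbert_sum (I : Type) (H : I -> hilbert R) (K : hilbert R)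
    (J : forall i, 'B(H i, K)) : Prop :=
  [/\ forall i, is_isometry (J i),
      forall i k, i <> k -> forall x y, dot (J i x) (J k y) = 0 &
      forall M : closed_subspace K,
        (forall i x, subspace_set M (J i x)) -> subspace_set M = setT].

Definition is_op_sum (I : Type) (H : I -> hilbert R) (K : hilbert R)
    (J : forall i, 'B(H i, K)) (Y : forall i, 'B(H i)) (X : 'B(K)) : Prop :=
  forall i x, X (J i x) = J i (Y i x).

Definition uniformly_bounded (g : nat) (I : Type) (H : I -> hilbert R)
    (Y : forall i, op_tuple g (H i)) : Prop :=
  exists M : R, forall i j x, `|Y i j x| <= (M%:C)%C * `|x|.

Definition is_restriction (K : hilbert R) (M : closed_subspace K) (X : 'B(K))
    (Y : 'B(subspace_hilbert M)) : Prop :=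
  forall x : subspace_of M, subspace_val (Y x) = X (subspace_val x).

Definition free_domain (g : nat) := forall H : hilbert R, set (op_tuple g H).

Record real_free_set (g : nat) (D : free_domain g) : Prop := RealFreeSet {
  free_set_self_adjoint : forall H X, D H X -> forall j, self_adjoint (X j);
  free_set_unitary : forall H K (U : 'B(H, K)) X,
    is_unitary U -> D K X -> D H (tuple_compression U X);
  free_set_reducing : forall K (M : closed_subspace K) X
      (Y : op_tuple g (subspace_hilbert M)),
    D K X -> (forall j, reduces (subspace_set M) (X j)) ->
    (forall j, is_restriction (X j) (Y j)) -> D (subspace_hilbert M) Y;
  free_set_sum : forall (I : Type) (H : I -> hilbert R) K
      (J : forall i, 'B(H i, K)) (Y : forall i, op_tuple g (H i)) X,
    inhabited I -> ([set: I] #<= [set: set nat])%card -> hilbert_sum J ->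
    (forall i, D (H i) (Y i)) -> uniformly_bounded Y ->
    (forall j, is_op_sum J (fun i => Y i j) (X j)) -> D K X
}.

(* f is total on tuples: only its values on D are constrained or used. *)
Record free_function (g : nat) (D : free_domain g)
    (f : forall H : hilbert R, op_tuple g H -> 'B(H)) : Prop := FreeFunction {
  free_fun_self_adjoint : forall H X, D H X -> self_adjoint (f H X);
  free_fun_unitary : forall H K (U : 'B(H, K)) X,
    is_unitary U -> D K X -> f H (tuple_compression U X) = compression U (f K X);
  free_fun_reducing : forall K (M : closed_subspace K) X
      (Y : op_tuple g (subspace_hilbert M)),
    D K X -> (forall j, reduces (subspace_set M) (X j)) ->
    (forall j, is_restriction (X j) (Y j)) ->
    is_restriction (f K X) (f (subspace_hilbert M) Y);
  free_fun_sum : forall (I : Type) (H : I -> hilbert R) K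
      (J : forall i, 'B(H i, K)) (Y : forall i, op_tuple g (H i)) X,
    inhabited I -> ([set: I] #<= [set: set nat])%card -> hilbert_sum J ->
    (forall i, D (H i) (Y i)) -> uniformly_bounded Y ->
    (forall j, is_op_sum J (fun i => Y i j) (X j)) ->
    is_op_sum J (fun i => f (H i) (Y i)) (f K X)
}.

Definition intrinsically_convex (g r : nat) (Gamma : graded_map g r)
    (D : free_domain g) (f : forall H : hilbert R, op_tuple g H -> 'B(H)) :=
  forall (H K : hilbert R) (V : 'B(H, K)) (X : op_tuple g K),
    is_isometry V -> gamma_pair Gamma X V ->
    D K X -> D H (tuple_compression V X) ->
    f H (tuple_compression V X) ⪯ compression V (f K X).

Definition intrinsically_concave (g r : nat) (Gamma : graded_map g r)
    (D : free_domain g) (f : forall H : hilbert R, op_tuple g H -> 'B(H)) :=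
  forall (H K : hilbert R) (V : 'B(H, K)) (X : op_tuple g K),
    is_isometry V -> gamma_pair Gamma X V ->
    D K X -> D H (tuple_compression V X) ->
    compression V (f K X) ⪯ f H (tuple_compression V X).

End FreeFunctions.

Arguments gamma_square {R} g H X k.

(* Main.v *)
Require Import Defs.
From mathcomp Require Import all_boot all_order all_algebra.
From mathcomp Require Import all_classical all_reals all_analysis.
From mathcomp Require Import complex ring lra.

Local Open Scope classical_set_scope.
Local Open Scope ring_scope.

Import Order.TTheory GRing.Theory Num.Theory.
Import numFieldNormedType.Exports.

(** Why the statement holds. Let [V] be an isometry and [X] a self-adjoint
tuple. The last coordinate of the pair condition compares
[V^* (\sum_j X_j^2) V] with [\sum_j (V^* X_j V)^2]. Writing [P = V V^*], the
difference of the two sides, evaluated against a vector [x], is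
[\sum_j |(1 - P) X_j V x|^2], by Pythagoras in each summand
([rdot_residual]). A sum of nonnegative terms vanishes only termwise, so the
condition says precisely that every [X_j] maps the range of [V] into itself
([gamma_pair_invariant], with converse [invariant_gamma_pair]); for a
self-adjoint operator an invariant set is automatically reducing
([reduces_self_adjoint]).

For a free function [f], factor [V] as the unitary [U] from its domain onto
its range [M], a closed subspace, followed by the inclusion of [M]. Because
[M] reduces [X], the tuple restricts to a tuple [Y] on [M], and
[V^* X V = U^* Y U]. Invariance of [f] under [U] and compatibility with the
restriction to [M] then give the equality [f (V^* X V) = V^* f(X) V]
([free_function_compression]), which is convexity and concavity at once.

Adjoints are defined by choice, with default value [0], so all of this needs
their existence, hence the Riesz representation theorem ([riesz]). It is
obtained variationally: the representing vector of a bounded functional [p]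
is the minimizer of [|x|^2 - 2 p(x)]. The argument is carried out for the real
inner product [rdot], the real part of [dot], which already separates points
([rdotr_inj]) and lets order reasoning take place in [R] instead of [R[i]]. *)

(** * The real inner product underlying a complex Hilbert space *)

Section RealInnerProduct.
Context {R : realType} {H : hilbert R}.
Implicit Types x y z : H.

Definition rdot x y : R := complex.Re (dot x y).

Lemma dotC x y : dot x y = Num.conj (dot y x).
Proof. by rewrite (hermC (dot (h := H)) x y) expr0 mul1r. Qed.

Lemma dotDl x y z : dot (x + y) z = dot x z + dot y z.
Proof. exact: (linearDl (dot (h := H))). Qed.

Lemma dotZl a x z : dot (a *: x) z = a * dot x z.
Proof. exact: (linearZl_LR (dot (h := H))). Qed.

Lemma dotBl x y z : dot (x - y) z = dot x z - dot y z.
Proof. exact: (linearBl (dot (h := H))). Qed.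

Lemma dotPr a x y z : dot x (a *: y + z) = Num.conj a * dot x y + dot x z.
Proof. exact: (linearPr (dot (h := H)) x). Qed.

Lemma rdotC x y : rdot x y = rdot y x.
Proof. by rewrite /rdot dotC; case: (dot y x). Qed.

Lemma rdotDl x y z : rdot (x + y) z = rdot x z + rdot y z.
Proof. by rewrite /rdot dotDl raddfD. Qed.

Lemma rdotZl (a : R) x z : rdot ((a%:C)%C *: x) z = a * rdot x z.
Proof. by rewrite /rdot dotZl; case: (dot x z) => u v /=; rewrite mul0r subr0. Qed.

Lemma rdotDr x y z : rdot z (x + y) = rdot z x + rdot z y.
Proof. by rewrite rdotC rdotDl !(rdotC z). Qed.

Lemma rdotZr (a : R) x z : rdot z ((a%:C)%C *: x) = a * rdot z x.
Proof. by rewrite rdotC rdotZl rdotC. Qed.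

Lemma rdotBl x y z : rdot (x - y) z = rdot x z - rdot y z.
Proof. by rewrite /rdot dotBl raddfB. Qed.

Lemma rdotBr x y z : rdot z (x - y) = rdot z x - rdot z y.
Proof. by rewrite rdotC rdotBl !(rdotC z). Qed.

Lemma normr_Re x : `|x| = ((complex.Re `|x|)%:C)%C.
Proof. by rewrite RRe_real// normr_real. Qed.

Lemma Re_norm_ge0 x : 0 <= complex.Re `|x|.
Proof. by rewrite -ler0c -normr_Re. Qed.

Lemma rdot_norm x : rdot x x = complex.Re `|x| ^+ 2.
Proof. by rewrite /rdot dot_norm normr_Re -rmorphXn. Qed.

Lemma rdot_eq0 x : rdot x x = 0 -> x = 0.
Proof.
rewrite rdot_norm => /eqP; rewrite sqrf_eq0 => /eqP x0.
by apply: normr0_eq0; rewrite normr_Re x0.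
Qed.

(** The real part of the inner product still determines vectors, which is what
makes it possible to check operator identities through [rdot] alone. *)
Lemma rdotr_inj y z : (forall x, rdot x y = rdot x z) -> y = z.
Proof. by move=> yz; apply/subr0_eq/rdot_eq0; rewrite rdotBr yz subrr. Qed.

Lemma rdotr_sum (I : finType) x (F : I -> H) :
  rdot x (\sum_i F i) = \sum_i rdot x (F i).
Proof.
apply: (big_morph (rdot x)) => [y z|]; first exact: rdotDr.
by rewrite -[0](subrr 0) rdotBr subrr.
Qed.

Lemma rdot_ge0 x : 0 <= rdot x x.
Proof. by rewrite rdot_norm sqr_ge0. Qed.

Lemma rdot_le_norm x y :
  rdot x y <= complex.Re `|x| * complex.Re `|y|.
Proof.
have x_ge0 := Re_norm_ge0 x; have y_ge0 := Re_norm_ge0 y.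
have rdot0 z : rdot 0 z = 0 by rewrite -[0](subrr 0) rdotBl subrr.
have null z : complex.Re `|z| = 0 -> z = 0.
  by move=> z0; apply: normr0_eq0; rewrite normr_Re z0.
have [/null ->|x0] := eqVneq (complex.Re `|x|) 0.
  by rewrite rdot0 mulr_ge0// Re_norm_ge0.
have [/null ->|y0] := eqVneq (complex.Re `|y|) 0.
  by rewrite rdotC rdot0 mulr_ge0// Re_norm_ge0.
have xy_gt0 : 0 < complex.Re `|x| * complex.Re `|y|.
  by rewrite mulr_gt0// lt_neqAle eq_sym ?x0 ?y0.
(* For [u = |y| x - |x| y], [|u|^2 = 2 |x| |y| (|x| |y| - rdot x y)]. *)
have := rdot_ge0 (((complex.Re `|y|)%:C)%C *: x - ((complex.Re `|x|)%:C)%C *: y).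
rewrite !(rdotBl, rdotBr, rdotZl, rdotZr) (rdotC y x) !rdot_norm => sq_ge0.
rewrite -subr_ge0 -(pmulr_rge0 _ xy_gt0).
by move: sq_ge0; lra.
Qed.

End RealInnerProduct.

(** * Riesz representation *)

Section RieszRepresentation.
Context {R : realType} {H : hilbert R}.
Implicit Types x y z h : H.

(** The functional is represented by the minimizer of the energy
[E x = |x|^2 - 2 p x]. Boundedness of [p] bounds [E] from below, the
parallelogram identity makes the sublevel sets of [E] near its infimum a
Cauchy filter, and stationarity of [E] at the limit is the representation
formula. *)
Lemma real_riesz (p : H -> R) :
  (forall x y, p (x + y) = p x + p y) ->
  (forall (a : R) x, p ((a%:C)%C *: x) = a * p x) ->
  (exists M : R, forall x, p x <= M * complex.Re `|x|) ->
  exists z, forall x, p x = rdot x z.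
Proof.
move=> pD pZ [M pM].
pose E x := rdot x x - p x *+ 2.
have E_lb x : - M ^+ 2 <= E x.
  have := pM x; have := sqr_ge0 (complex.Re `|x| - M).
  by rewrite /E rdot_norm; nra.
have E_inf : has_inf (range E).
  split; first by exists (E 0), 0.
  by exists (- M ^+ 2) => _ [x _ <-].
pose m := inf (range E).
have m_le x : m <= E x by apply: ge_inf; [case: E_inf | exists x].
have E_near_m e : 0 < e -> exists x, E x < m + e.
  by move=> /(inf_adherent)/(_ E_inf)[_ [x _ <-]]; exists x.
(* Apply [m <= E] at the midpoint: [|x - y|^2 = 2 E x + 2 E y - 4 E((x + y)/2)]. *)
have E_close e x y : E x < m + e -> E y < m + e -> rdot (x - y) (x - y) < 4 * e.
  have := m_le ((2^-1%:C)%C *: (x + y)).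
  rewrite /E pZ pD !(rdotBl, rdotBr, rdotDl, rdotDr, rdotZl, rdotZr) (rdotC y x).
  by lra.
pose F := filter_from [set e : R | 0 < e] (fun e => [set x | E x < m + e]).
have F_proper : ProperFilter F.
  apply: filter_from_proper; last by move=> e /E_near_m.
  apply: filter_from_filter; first by exists 1; exact: ltr01.
  move=> e f /= e0 f0; exists (Num.min e f); first by rewrite /= lt_min e0.
  by move=> x /=; rewrite -ltrBlDl lt_min !ltrBlDl => /andP[].
have norm_lt x (e : R) : 0 < e -> rdot x x < e ^+ 2 -> `|x| < (e%:C)%C.
  move=> e0; rewrite rdot_norm normr_Re ltcR => xe.
  by rewrite ltNge; apply/negP => ex; nra.
have F_cauchy : cauchy F.
  apply: cauchy_exP => e e0.
  have eE : e = ((complex.Re e)%:C)%C by rewrite RRe_real// gtr0_real.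
  have re0 : 0 < complex.Re e by move: e0; rewrite {1}eE ltcR.
  have [x Ex] := E_near_m (complex.Re e ^+ 2 / 4) ltac:(nra).
  exists x, (complex.Re e ^+ 2 / 4) => [|y /= Ey]; first by rewrite /=; nra.
  rewrite -ball_normE /= eE; apply: norm_lt => //.
  by have := E_close _ _ _ Ex Ey; lra.
have /cvg_ex[l Fl] : cvg F by exact: cauchy_cvg.
have {}Fl : forall e : R[i], 0 < e -> F [set x | `|l - x| < e].
  by move: Fl; rewrite -[X in X --> _]/(id @ F) => /cvgrPdist_lt.
(* [E (l + h) - E l >= 0] is proved without continuity of [E], by comparing
   [E (x + h)] and [E x] at near-minimizers [x] close to [l]. *)
have l_min h : 0 <= rdot h h + (rdot h l - p h) *+ 2.
  apply/ler_addgt0Pr => e e0.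
  have sh := rdot_ge0 h.
  (* [d] bounds both [E x - m] and [|l - x|]; together they cost
     [d * (|h|^2 + 2)]. *)
  pose d := e / (rdot h h + 2).
  have d0 : 0 < d by rewrite divr_gt0//; lra.
  have eE : e = d * (rdot h h + 2) by rewrite divfK//; lra.
  have dC0 : 0 < (d%:C)%C by rewrite ltcR.
  have Fd : F [set x | E x < m + d] by exists d.
  have [x [Ex]] := filter_ex (filterI Fd (Fl _ dC0)).
  rewrite /= normr_Re ltcR => lx.
  have lx2 : rdot (l - x) (l - x) < d ^+ 2.
    by rewrite rdot_norm; have := Re_norm_ge0 (l - x); nra.
  (* Positivity of [|d h + (l - x)|^2] bounds the cross term [rdot h (l - x)]
     by [d * (|h|^2 + 1) / 2]. *)
  have := rdot_ge0 ((d%:C)%C *: h + (l - x)).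
  have := m_le (x + h).
  move: Ex lx2; rewrite /= /E pD.
  rewrite !(rdotBl, rdotBr, rdotDl, rdotDr, rdotZl, rdotZr).
  rewrite (rdotC x l) (rdotC x h) (rdotC l h).
  rewrite eE; move: (rdot h h) (rdot h l) (rdot h x) (p h) sh.
  move=> A B C D ? ? ? ? ?.
  have : 0 < d * (d * A + (B - C) *+ 2 + d) by lra.
  by rewrite pmulr_rgt0//; lra.
exists l => x.
suff : rdot x l - p x = 0 by lra.
have sx := rdot_ge0 x.
set c := rdot x l - p x.
(* The first-order term [c] of the variation is excluded by moving along [x]
   by a step proportional to [- c]. *)
have := l_min (((- c / (rdot x x + 1))%:C)%C *: x).
rewrite pZ !(rdotZl, rdotZr) -!mulrBr -/c.
set t := - c / _.
have tE : t * (rdot x x + 1) = - c by rewrite divfK//; lra.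
have -> : c = - (t * (rdot x x + 1)) by rewrite tE opprK.
move=> t_ge0; suff -> : t = 0 by rewrite mul0r oppr0.
by apply/eqP; rewrite -sqrf_eq0; apply/eqP; nra.
Qed.

(** The imaginary part of a complex-linear functional is recovered from its
real part, since [Im (phi x) = - Re (phi (i x))]; hence bounding and
representing the real part suffices. *)
Lemma riesz (phi : H -> R[i]) :
  scalar phi ->
  (exists M : R, forall x, complex.Re (phi x) <= M * complex.Re `|x|) ->
  exists z, forall x, phi x = dot x z.
Proof.
move=> phiL [M phiM].
have phiD x y : phi (x + y) = phi x + phi y.
  by have := phiL 1 x y; rewrite scale1r mul1r.
have phiZ a x : phi (a *: x) = a * phi x.
  have phi0 : phi 0 = 0 by apply: (addIr (phi 0)); rewrite -phiD !add0r.
  by rewrite -[a *: x]addr0 phiL phi0 addr0.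
have [|||z phiz] := @real_riesz (fun x => complex.Re (phi x)).
- by move=> x y; rewrite phiD raddfD.
- by move=> a x; rewrite phiZ; case: (phi x) => u v /=; rewrite mul0r subr0.
- by exists M.
exists z => x.
have Re_i (w : R[i]) : complex.Im w = - complex.Re ('i%C * w).
  by case: w => u v /=; rewrite mul0r mul1r sub0r opprK.
apply/eqP; rewrite eq_complex phiz eqxx /= !Re_i -dotZl -phiZ phiz.
exact: eqxx.
Qed.

End RieszRepresentation.

(** * Adjoints of bounded operators *)

Section BoundedOperator.
Context {R : realType}.

Lemma adjoint_exists {H K : hilbert R} (A : 'B(H, K)) :
  exists W : 'B(K, H), forall x y, dot (A x) y = dot x (W y).
Proof.
have [M AM] := bop_bounded A.
have A_le x : complex.Re `|A x| <= M * complex.Re `|x|.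
  by rewrite -lecR rmorphM /= -!normr_Re.
have dotA_linear y : scalar (fun x => dot (A x) y).
  by move=> a x z; rewrite bop_linear dotDl dotZl.
have /choice[W WE] : forall y, exists w, forall x, dot (A x) y = dot x w.
  move=> y; have [|w wE] := riesz _ (dotA_linear y); last by exists w.
  exists (M * complex.Re `|y|) => x /=.
  apply: le_trans (rdot_le_norm (A x) y) _.
  by rewrite mulrAC ler_wpM2r// Re_norm_ge0.
have W_linear : linear W.
  by move=> a y z; apply: rdotr_inj => x; rewrite /rdot dotPr -!WE dotPr.
have W_bounded : exists N : R, forall y, `|W y| <= (N%:C)%C * `|y|.
  exists `|M| => y; rewrite (normr_Re (W y)) (normr_Re y) -rmorphM lecR.
  (* [|W y|^2 = rdot (A (W y)) y <= M |W y| |y|], then divide by [|W y|]. *)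
  have : complex.Re `|W y| ^+ 2 <= complex.Re `|A (W y)| * complex.Re `|y|.
    by rewrite -rdot_norm /rdot -WE; exact: rdot_le_norm.
  have := A_le (W y); have := ler_norm M; have := normr_ge0 M.
  have := Re_norm_ge0 (W y); have := Re_norm_ge0 y.
  move: (complex.Re `|W y|) (complex.Re `|y|) (complex.Re `|A (W y)|) => w n a.
  move=> n0 w0 M0 Mle aw waw; rewrite leNgt; apply/negP => Mnw.
  have : w * w <= (`|M| * n) * w.
    apply: (le_trans waw); rewrite mulrAC ler_wpM2r//.
    by apply: (le_trans aw); rewrite ler_wpM2r.
  by rewrite leNgt ltr_pM2r ?Mnw// (le_lt_trans _ Mnw)// mulr_ge0.
by exists (BoundedOp W_linear W_bounded) => x y /=; rewrite WE.
Qed.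

(** By Riesz, the default value in the definition of [adjoint] is never the
one selected. *)
Lemma adjointE {H K : hilbert R} (A : 'B(H, K)) x y :
  dot (A x) y = dot x (adjoint A y).
Proof.
rewrite /adjoint; case: xgetP => [W _ //|noW].
by have [W AW] := adjoint_exists A; case: (noW W).
Qed.

Lemma rdot_adjoint {H K : hilbert R} (A : 'B(H, K)) x y :
  rdot (A x) y = rdot x (adjoint A y).
Proof. by rewrite /rdot adjointE. Qed.

Lemma self_adjointE {H : hilbert R} (A : 'B(H)) x y :
  self_adjoint A -> dot (A x) y = dot x (A y).
Proof. by rewrite adjointE => ->. Qed.

Lemma continuous_bop {H K : hilbert R} (A : 'B(H, K)) : continuous A.
Proof.
apply/bounded_linear_continuous/bounded_funP => r.
have [M AM] := bop_bounded A.
exists ((`|M|%:C)%C * r) => x xr; apply: le_trans (AM x) _.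
apply: (@le_trans _ _ ((`|M|%:C)%C * `|x|)).
  by rewrite ler_wpM2r// lecR ler_norm.
by rewrite ler_wpM2l// lecR.
Qed.

End BoundedOperator.

(** * Isometries and their ranges *)

Section Isometry.
Context {R : realType} {H K : hilbert R} {V : 'B(H, K)}.
Hypothesis V_isometry : is_isometry V.

Lemma rdot_isometry x y : rdot (V x) (V y) = rdot x y.
Proof.
have sqV z : rdot (V z) (V z) = rdot z z by rewrite !rdot_norm V_isometry.
have := sqV (x + y); rewrite linearD !(rdotDl, rdotDr) !sqV.
by rewrite (rdotC (V y)) (rdotC y); lra.
Qed.

Lemma isometryK x : adjoint V (V x) = x.
Proof. by apply: rdotr_inj => y; rewrite -rdot_adjoint rdot_isometry. Qed.

(** [V V^*] is the projection onto the range of [V], so membership in the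
range is a fixed-point equation; it also exhibits the range as closed. *)
Lemma range_isometryP z : range V z <-> V (adjoint V z) = z.
Proof. by split=> [[x _ <-]|<-]; [rewrite isometryK | exists (adjoint V z)]. Qed.

(** Pythagoras: the squared distance from [z] to the range of [V], where
[|V V^* z| = |V^* z|]. *)
Lemma rdot_residual z :
  rdot (z - V (adjoint V z)) (z - V (adjoint V z)) =
  rdot z z - rdot (adjoint V z) (adjoint V z).
Proof.
rewrite !(rdotBl, rdotBr) rdot_isometry (rdotC z) !rdot_adjoint.
by lra.
Qed.

Lemma closed_range_isometry : closed (range V).
Proof.
have -> : range V = (fun z => V (adjoint V z) - z) @^-1` [set 0].
  apply/seteqP; split=> z /=; first by move/range_isometryP => ->; exact: subrr.
  by move/subr0_eq/range_isometryP.
apply: preimage_closed.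
  move=> z _; apply: cvgB; last exact: cvg_id.
  apply: continuous_comp; exact: continuous_bop.
exact/accessible_closed_set1/hausdorff_accessible/norm_hausdorff.
Qed.

Definition range_subspace : closed_subspace K.
Proof.
apply: (@ClosedSubspace R K (range V)); last exact: closed_range_isometry.
  by exists 0 => //; exact: linear0.
by move=> a _ _ [x _ <-] [y _ <-]; exists (a *: x + y) => //; exact: linearP.
Defined.

End Isometry.

(** * Operators into a closed subspace *)

Section Corestriction.
Context {R : realType} {K : hilbert R} {M : closed_subspace K}.

Lemma mem_subspaceP {x} : subspace_set M x -> x \in subspace_pred M.
Proof. by move=> Mx; apply/asboolP. Qed.

Definition corestrict_fun {H : hilbert R} {A : 'B(H, K)}
  (AM : forall x, subspace_set M (A x)) : H -> subspace_hilbert M :=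
  fun x => SubspaceOf (mem_subspaceP (AM x)).

Definition corestrict {H : hilbert R} {A : 'B(H, K)}
  (AM : forall x, subspace_set M (A x)) : 'B(H, subspace_hilbert M).
Proof.
apply: (@BoundedOp _ _ _ (corestrict_fun AM)); last exact: (bop_bounded A).
by move=> a x y; apply: val_inj => /=; rewrite linearP.
Defined.

Definition inclusion : 'B(subspace_hilbert M, K).
Proof.
apply: (@BoundedOp _ (subspace_hilbert M) K (@subspace_val _ _ M)) => //.
by exists 1 => x; rewrite mul1r.
Defined.

Lemma adjoint_corestrict {H : hilbert R} {A : 'B(H, K)}
    (AM : forall x, subspace_set M (A x)) y :
  adjoint (corestrict AM) y = adjoint A (subspace_val y).
Proof. by apply: rdotr_inj => x; rewrite -!rdot_adjoint. Qed.

(** Compressing along [V] only sees the part of [X] living on a closed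
subspace that contains the range of [V]. *)
Lemma compression_corestrict {H : hilbert R} {V : 'B(H, K)}
    (VM : forall x, subspace_set M (V x)) {X : 'B(K)} {Y : 'B(subspace_hilbert M)} :
  is_restriction X Y -> compression (corestrict VM) Y = compression V X.
Proof.
by move=> XY; apply: bounded_opP => x /=; rewrite adjoint_corestrict XY.
Qed.

Definition restrict {X : 'B(K)} (XM : invariant_under (subspace_set M) X) :
    'B(subspace_hilbert M).
Proof.
apply: (@corestrict _ (X \oB inclusion)) => x.
apply: XM; exact/asboolP/subspace_valP.
Defined.

End Corestriction.

(** * Pairs for the square map and free functions *)

Section GammaSquare.
Context {R : realType} {g : nat}.

Lemma sum_opE {H K : hilbert R} (I : finType) (A : I -> 'B(H, K)) x :
  (\sum_i A i) x = \sum_i A i x.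
Proof. exact: (big_morph (fun B : 'B(H, K) => B x)). Qed.

Lemma gamma_squareE {H : hilbert R} (X : op_tuple g H) x :
  gamma_square g H X ord_max x = \sum_j X j (X j x).
Proof. by rewrite /gamma_square unlift_none sum_opE. Qed.

Lemma gamma_square_lift {H : hilbert R} (X : op_tuple g H) j :
  gamma_square g H X (lift ord_max j) = X j.
Proof. by rewrite /gamma_square liftK. Qed.

Context {H K : hilbert R} {V : 'B(H, K)} {X : op_tuple g K}.
Hypotheses (V_isometry : is_isometry V) (X_sa : forall j, self_adjoint (X j)).

(** Evaluated at [x], the last coordinate of the pair condition says that the
squared distances from the [X_j V x] to the range of [V] add up to zero. *)
Lemma gamma_pair_invariant :
  gamma_pair (gamma_square g) X V -> forall j, invariant_under (range V) (X j).
Proof.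
move=> XV j _ [x _ <-].
apply/(range_isometryP V_isometry)/esym/subr0_eq/rdot_eq0.
pose d i := X i (V x) - V (adjoint V (X i (V x))).
have sum0 : \sum_i rdot (d i) (d i) = 0.
  have : rdot x (compression V (gamma_square g K X ord_max) x) =
      rdot x (gamma_square g H (tuple_compression V X) ord_max x) by rewrite XV.
  rewrite gamma_squareE -rdot_adjoint gamma_squareE !rdotr_sum => sumE.
  under eq_bigr do rewrite rdot_residual//.
  rewrite sumrB; apply/eqP; rewrite subr_eq0; apply/eqP.
  transitivity (\sum_i rdot (V x) (X i (X i (V x)))).
    by apply: eq_bigr => i _; rewrite /rdot self_adjointE.
  rewrite sumE; apply: eq_bigr => i _.
  rewrite -[in RHS]rdot_adjoint /tuple_compression /compression /=.
  by rewrite -rdot_adjoint [in RHS]/rdot -self_adjointE// rdotC.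
by apply: (psumr_eq0P _ sum0) => // i _; exact: rdot_ge0.
Qed.

Lemma reduces_self_adjoint (M : set K) (A : 'B(K)) :
  self_adjoint A -> invariant_under M A -> reduces M A.
Proof.
by move=> A_sa MA; split=> // y My x Mx; rewrite -self_adjointE// My//; exact: MA.
Qed.

(** On vectors [X_j V x] of the range of [V] the projection [V V^*] acts as
the identity and may be inserted between the two factors of each square. *)
Lemma invariant_gamma_pair :
  (forall j, invariant_under (range V) (X j)) -> gamma_pair (gamma_square g) X V.
Proof.
move=> VX k; apply: bounded_opP => x.
have [j ->|->] := unliftP ord_max k; first by rewrite !gamma_square_lift.
rewrite /= !gamma_squareE linear_sum; apply: eq_bigr => j _ /=.
suff -> : V (adjoint V (X j (V x))) = X j (V x) by [].
by apply/(range_isometryP V_isometry)/VX; exists x.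
Qed.

(** [V] is a unitary onto its range followed by an inclusion; the two
structural axioms of free functions handle the two factors. *)
Lemma free_function_compression (D : free_domain R g)
    (f : forall L : hilbert R, op_tuple g L -> 'B(L)) :
  real_free_set D -> free_function D f -> D K X ->
  (forall j, reduces (range V) (X j)) ->
  f H (tuple_compression V X) = compression V (f K X).
Proof.
move=> D_free f_free DX VX.
pose M := range_subspace V_isometry.
have VM x : subspace_set M (V x) by exists x.
pose U := corestrict VM.
have U_unitary : Defs.is_unitary U.
  split=> [x|]; first exact: V_isometry.
  apply/seteqP; split=> // y _.
  have /asboolP[x _ Vx] := subspace_valP y.
  by exists x => //; apply: val_inj.
pose Y j := restrict (M := M) (VX j).1.
have XY j : is_restriction (X j) (Y j) by [].
have DY : D (subspace_hilbert M) Y.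
  exact: (free_set_reducing (M := M) D_free DX VX XY).
have f_restr : is_restriction (f K X) (f (subspace_hilbert M) Y).
  exact: (free_fun_reducing (M := M) f_free DX VX XY).
have -> : tuple_compression V X = tuple_compression U Y.
  apply/funext => j.
  by rewrite /tuple_compression (compression_corestrict VM (XY j)).
by rewrite (free_fun_unitary f_free U_unitary DY) (compression_corestrict VM f_restr).
Qed.

End GammaSquare.

Theorem proposition6p5 (R : realType) (g : nat) :
  (forall (H K : hilbert R) (V : 'B(H, K)) (X : op_tuple g K),
     is_isometry V -> (forall j, self_adjoint (X j)) ->
     (gamma_pair (gamma_square g) X V <->
      forall j, reduces (range V) (X j)))
  /\
  (forall (D : free_domain R g)
     (f : forall H : hilbert R, op_tuple g H -> 'B(H)),
     real_free_set D -> free_function D f ->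
     intrinsically_convex (gamma_square g) D f /\
     intrinsically_concave (gamma_square g) D f).
Proof.
have pairP (H K : hilbert R) (V : 'B(H, K)) (X : op_tuple g K) :
    is_isometry V -> (forall j, self_adjoint (X j)) ->
    gamma_pair (gamma_square g) X V <-> forall j, reduces (range V) (X j).
  move=> V_isometry X_sa; split=> [XV j|XV].
    by apply: reduces_self_adjoint => //; exact: gamma_pair_invariant.
  by apply: invariant_gamma_pair => // j; exact: (XV j).1.
split=> // D f D_free f_free.
have loewner_refl (H : hilbert R) (A : 'B(H)) : A ⪯ A.
  by move=> x; rewrite subrr zero_opE (linear0l (dot (h := H))).
have f_compression (H K : hilbert R) (V : 'B(H, K)) (X : op_tuple g K) :
    is_isometry V -> gamma_pair (gamma_square g) X V -> D K X ->
    f H (tuple_compression V X) = compression V (f K X).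
  move=> V_isometry XV DX.
  have X_sa := free_set_self_adjoint D_free DX.
  have VX := (pairP _ _ _ _ V_isometry X_sa).1 XV.
  exact: (free_function_compression V_isometry _ _ D_free f_free DX VX).
by split=> H K V X V_isometry XV DX _; rewrite f_compression.
Qed.
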